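(* Let $M$ be a finite monoid, $K$ a subgroup of the group of units $G(M)$ of $M$, and $F$ a field of characteristic not dividing $|K|$. If $(\pi,V)$ and $(\sigma,W)$ are two irreducible representations of $M$ over $F$ with $V^K$ and $W^K$ nonzero and isomorphic as $\mathcal{H}_K$-modules, then $(\pi,V)\cong(\sigma,W)$ as representations of $M$.
   Context: A representation $(\pi,V)$ of a monoid $M$ over $F$ is an $F$-vector space $V$ together with a monoid homomorphism $\pi:M\to \mathrm{End}_F(V)$ (in particular $\pi(1)=\mathrm{id}_V$). It is irreducible if $V\neq 0$ and $V$ has no proper nonzero $M$-stable subspaces. $V^K=\{v\in V : \pi(k)v=v \text{ for all } k\in K\}$, and similarly $W^K=\{w\in W : \sigma(k)w=w \text{ for all } k\in K\}$. For functions $\phi,\psi:M\to F$, the convolution product is $(\phi*\psi)(m)=\sum_{y,z\in M,\ yz=m}\phi(y)\psi(z)$. $\mathcal{H}_K$ is the $F$-algebra, under addition and convolution, of functions $\phi:M\to F$ satisfying $\phi(k_1mk_2)=\phi(m)$ for all $k_1,k_2\in K$ and $m\in M$. For $\phi:M\to F$, define $\pi(\phi)v=\sum_{x\in M}\phi(x)\pi(x)v$ for $v\in V$, and similarly $\sigma(\phi)w=\sum_{x\in M}\phi(x)\sigma(x)w$ for $w\in W$. The algebra $\mathcal{H}_K$ acts on $V^K$ by $\phi\cdot v=\pi(\phi)v$ and on $W^K$ by $\phi\cdot w=\sigma(\phi)w$. *)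

(* Defs.v *)
From HB Require Import structures.
From mathcomp Require Import all_boot.

(* This structure must be declared before fingroup is loaded: Hierarchy-Builder
   rejects it once finStarMonoidType exists. *)
#[short(type="finMonoidType")]
HB.structure Definition FinMonoid := {M of monoid.Monoid M & Finite M}.

From mathcomp Require Import all_order all_fingroup all_algebra.

Set Implicit Arguments.
Unset Strict Implicit.
Unset Printing Implicit Defensive.

Import GRing.Theory.
Local Open Scope ring_scope.


Section Units.

Variable M : finMonoidType.

Definition is_unit : pred M :=
  [pred x : M | [exists y : M, (x * y == 1)%g && (y * x == 1)%g]].

Record units := MUnit { uval :> M; uvalP : is_unit uval }.

HB.instance Definition _ := [isSub for uval].
HB.instance Definition _ := [Finite of units by <:].

Lemma is_unit1 : is_unit 1%g.
Proof. by apply/existsP; exists 1%g; rewrite !mulg1 eqxx. Qed.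

Lemma is_unitM (x y : units) : is_unit (uval x * uval y)%g.
Proof.
have /existsP[x' /andP[/eqP xx' /eqP x'x]] := uvalP x.
have /existsP[y' /andP[/eqP yy' /eqP y'y]] := uvalP y.
apply/existsP; exists (y' * x')%g; apply/andP; split; apply/eqP.
  by rewrite mulgA -(mulgA (uval x)) yy' mulg1.
by rewrite mulgA -(mulgA y') x'x mulg1.
Qed.

Definition unit_inv_val (x : units) : M :=
  odflt 1%g [pick y : M | (uval x * y == 1)%g && (y * uval x == 1)%g].

Lemma unit_inv_valP (x : units) :
  (uval x * unit_inv_val x = 1)%g /\ (unit_inv_val x * uval x = 1)%g.
Proof.
rewrite /unit_inv_val; case: pickP => [y /andP[/eqP ? /eqP ?] // | no].
by have /existsP[y] := uvalP x; rewrite no.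
Qed.

Lemma is_unitV (x : units) : is_unit (unit_inv_val x).
Proof.
by apply/existsP; exists (uval x); have [-> ->] := unit_inv_valP x; rewrite eqxx.
Qed.

Definition unit_one : units := MUnit is_unit1.
Definition unit_mul (x y : units) : units := MUnit (is_unitM x y).
Definition unit_inv (x : units) : units := MUnit (is_unitV x).

Lemma unit_mulA : associative unit_mul.
Proof. by move=> x y z; apply: val_inj; rewrite /= mulgA. Qed.

Lemma unit_mul1 : left_id unit_one unit_mul.
Proof. by move=> x; apply: val_inj; rewrite /= mul1g. Qed.

Lemma unit_mulV : left_inverse unit_one unit_inv unit_mul.
Proof. by move=> x; apply: val_inj; have [] := unit_inv_valP x. Qed.

HB.instance Definition _ :=
  Finite_isGroup.Build units unit_mulA unit_mul1 unit_mulV.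

Lemma uval1 : uval 1%g = 1%g. Proof. by []. Qed.
Lemma uvalM (x y : units) : uval (x * y)%g = (uval x * uval y)%g.
Proof. by []. Qed.
Lemma uvalVl (x : units) : (uval x^-1 * uval x = 1)%g.
Proof. by rewrite -uvalM mulVg. Qed.
Lemma uvalVr (x : units) : (uval x * uval x^-1 = 1)%g.
Proof. by rewrite -uvalM mulgV. Qed.

End Units.

Arguments uval {M} _.

Record representation (F : fieldType) (M : finMonoidType) (V : lmodType F) :=
  Representation {
    rep_op :> M -> {linear V -> V};
    rep_op1 : forall v, rep_op 1%g v = v;
    rep_opM : forall x y v, rep_op (x * y)%g v = rep_op x (rep_op y v)
  }.

Section Representations.

Variables (F : fieldType) (M : finMonoidType).

Definition rep_stable (V : lmodType F) (rho : representation M V)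
  (U : {pred V}) : Prop :=
  forall (m : M) (v : V), v \in U -> rho m v \in U.

(* Subspaces are boolean predicates, as for all MathComp closure predicates;
   under the usual classical axioms every subset is of this form. *)
Definition rep_irreducible (V : lmodType F) (rho : representation M V) : Prop :=
  (exists v : V, v != 0) /\
  (forall U : {pred V}, submod_closed U -> rep_stable rho U ->
     (forall v, v \in U -> v = 0) \/ (forall v, v \in U)).

Definition rep_iso (V W : lmodType F)
  (pi : representation M V) (sigma : representation M W) : Prop :=
  exists f : {linear V -> W},
    bijective f /\ forall (m : M) (v : V), f (pi m v) = sigma m (f v).

Definition rep_fun (V : lmodType F) (rho : representation M V)
  (phi : {ffun M -> F}) (v : V) : V := \sum_(x : M) phi x *: rho x v.

Definition conv (phi psi : {ffun M -> F}) : {ffun M -> F} :=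
  [ffun m => \sum_(p : M * M | (p.1 * p.2)%g == m) phi p.1 * psi p.2].

End Representations.

(* The Hecke algebra H_K is unital, with identity the normalized indicator
   function of K, only because the characteristic of F does not divide |K|;
   this is why the types below are indexed by a proof of that fact. *)
Section Hecke.

Variables (F : fieldType) (M : finMonoidType) (K : {group units M}).

Definition biinvariant : {pred {ffun M -> F}} :=
  [pred phi : {ffun M -> F} |
    [forall k1 in K, forall k2 in K, forall m : M,
       phi (uval k1 * m * uval k2)%g == phi m]].

Lemma biinvariantP (phi : {ffun M -> F}) :
  reflect (forall k1 k2 m, k1 \in K -> k2 \in K ->
             phi (uval k1 * m * uval k2)%g = phi m)
          (phi \in biinvariant).
Proof.
apply: (iffP idP) => [/forall_inP Hphi k1 k2 m K1 K2 | Hphi].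
  by have /forall_inP/(_ k2 K2)/forallP/(_ m)/eqP := Hphi k1 K1.
apply/forall_inP => k1 K1; apply/forall_inP => k2 K2.
by apply/forallP => m; apply/eqP/Hphi.
Qed.

Lemma biinvariant_zmod : zmod_closed biinvariant.
Proof.
split=> [|phi psi /biinvariantP Hphi /biinvariantP Hpsi].
  by apply/biinvariantP => k1 k2 m _ _; rewrite !ffunE.
by apply/biinvariantP => k1 k2 m K1 K2; rewrite !ffunE Hphi ?Hpsi.
Qed.

HB.instance Definition _ := GRing.isZmodClosed.Build _ biinvariant biinvariant_zmod.

Lemma sum_conv (V : lmodType F) (phi psi : {ffun M -> F}) (g : M -> V) :
  \sum_m conv phi psi m *: g m
  = \sum_y \sum_z phi y *: (psi z *: g (y * z)%g).
Proof.
under eq_bigr => m _ do rewrite ffunE scaler_suml.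
rewrite (exchange_big_dep predT) //= [RHS]pair_big /=.
by apply: eq_bigr => p _; rewrite (big_pred1 (p.1 * p.2)%g) ?scalerA.
Qed.

Lemma convE (phi psi : {ffun M -> F}) (m : M) :
  conv phi psi m = \sum_y \sum_z phi y * (psi z * ((y * z)%g == m)%:R).
Proof.
rewrite ffunE big_mkcond /= pair_big /=; apply: eq_bigr => p _.
by case: ifP => _; rewrite ?mulr1 ?mulr0.
Qed.

Lemma convA : associative (@conv F M).
Proof.
move=> phi psi chi; apply/ffunP => m.
rewrite [in RHS]convE.
transitivity (\sum_x conv phi psi x *:
   (\sum_z chi z * ((x * z)%g == m)%:R : F^o)); last first.
  by apply: eq_bigr => x _; rewrite -mulr_sumr.
rewrite sum_conv convE; apply: eq_bigr => y _.
rewrite -mulr_sumr -scaler_sumr; congr (_ * _).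
transitivity (\sum_x conv psi chi x *: (((y * x)%g == m)%:R : F^o)) => //.
rewrite sum_conv; apply: eq_bigr => z _; rewrite -scaler_sumr; congr (_ * _).
by apply: eq_bigr => t _; rewrite mulgA.
Qed.

Lemma convDl : left_distributive (@conv F M) +%R.
Proof.
move=> phi psi chi; apply/ffunP => m; rewrite !ffunE -big_split /=.
by apply: eq_bigr => p _; rewrite ffunE mulrDl.
Qed.

Lemma convDr : right_distributive (@conv F M) +%R.
Proof.
move=> phi psi chi; apply/ffunP => m; rewrite !ffunE -big_split /=.
by apply: eq_bigr => p _; rewrite ffunE mulrDr.
Qed.

Lemma eq_mulVu (u : units M) (x m : M) :
  ((uval u * x)%g == m) = (x == (uval u^-1 * m)%g).
Proof.
apply/eqP/eqP => [<- | ->]; first by rewrite mulgA uvalVl mul1g.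
by rewrite mulgA uvalVr mul1g.
Qed.

Lemma eq_muluV (u : units M) (x m : M) :
  ((x * uval u)%g == m) = (x == (m * uval u^-1)%g).
Proof.
apply/eqP/eqP => [<- | ->]; first by rewrite -mulgA uvalVr mulg1.
by rewrite -mulgA uvalVl mulg1.
Qed.

Lemma conv_biinvariant (phi psi : {ffun M -> F}) :
  phi \in biinvariant -> psi \in biinvariant -> conv phi psi \in biinvariant.
Proof.
move=> /biinvariantP Hphi /biinvariantP Hpsi.
apply/biinvariantP => k1 k2 m K1 K2; rewrite !ffunE.
pose h (p : M * M) := ((uval k1 * p.1)%g, (p.2 * uval k2)%g).
have hbij : bijective h.
  exists (fun p => ((uval k1^-1 * p.1)%g, (p.2 * uval k2^-1)%g)) => -[x y] /=;
    rewrite /h /=; congr (_, _).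
  - by rewrite mulgA uvalVl mul1g.
  - by rewrite -mulgA uvalVr mulg1.
  - by rewrite mulgA uvalVr mul1g.
  - by rewrite -mulgA uvalVl mulg1.
rewrite (reindex h) /=; last exact: onW_bij.
apply: eq_big => [p | p _] /=.
  rewrite mulgA eq_muluV -(mulgA _ (uval k2)) uvalVr mulg1.
  by rewrite -mulgA eq_mulVu mulgA uvalVl mul1g.
congr (_ * _).
  by have /= := Hphi k1 1%g p.1 K1 (group1 K); rewrite mulg1.
by have /= := Hpsi 1%g k2 p.2 (group1 K) K2; rewrite mul1g.
Qed.

Definition hecke_unit : {ffun M -> F} :=
  [ffun m => if m \in [set uval k | k in K] then #|K|%:R^-1 else 0].

Lemma sum_hecke_unit (V : lmodType F) (g : M -> V) :
  \sum_m hecke_unit m *: g m = #|K|%:R^-1 *: \sum_(k in K) g (uval k).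
Proof.
rewrite scaler_sumr.
rewrite -(big_imset (fun m => #|K|%:R^-1 *: g m)) /=; last first.
  by move=> k1 k2 _ _; apply: val_inj.
rewrite [RHS]big_mkcond; apply: eq_bigr => m _; rewrite ffunE.
by case: ifP => _ //; rewrite scale0r.
Qed.

Lemma sum_hecke_unitF (g : M -> F) :
  \sum_m hecke_unit m * g m = #|K|%:R^-1 * \sum_(k in K) g (uval k).
Proof. exact: (sum_hecke_unit (g : M -> F^o)). Qed.

Lemma hecke_unit_biinvariant : hecke_unit \in biinvariant.
Proof.
apply/biinvariantP => k1 k2 m K1 K2; rewrite !ffunE.
congr (if _ then _ else _); apply/imsetP/imsetP => -[k Kk].
  move=> /eqP; rewrite eq_muluV eq_mulVu => /eqP ->.
  by exists (k1^-1 * (k * k2^-1))%g; rewrite ?groupM ?groupV.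
by move=> ->; exists (k1 * k * k2)%g; rewrite ?groupM.
Qed.

Hypothesis hK : [pchar F]^'.-nat #|K|.

Lemma natK_neq0 : #|K|%:R != 0 :> F.
Proof. by rewrite natf_neq0_pchar. Qed.


Lemma conv_unitl (phi : {ffun M -> F}) :
  phi \in biinvariant -> conv hecke_unit phi = phi.
Proof.
move=> /biinvariantP Hphi; apply/ffunP => m; rewrite convE.
transitivity (\sum_y hecke_unit y *
   (\sum_z phi z * ((y * z)%g == m)%:R)).
  by apply: eq_bigr => y _; rewrite -mulr_sumr.
rewrite sum_hecke_unitF (eq_bigr (fun=> phi m)) => [|k Kk].
  by rewrite sumr_const -[phi m *+ _]mulr_natl mulKf ?natK_neq0.
rewrite (bigD1 (uval k^-1 * m)%g) //= eq_mulVu eqxx mulr1 big1 ?addr0.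
  by rewrite -[LHS](congr1 phi (mulg1 _)) (Hphi k^-1%g 1%g) ?groupV ?group1.
by move=> z /negPf nz; rewrite eq_mulVu nz mulr0.
Qed.

Lemma conv_unitr (phi : {ffun M -> F}) :
  phi \in biinvariant -> conv phi hecke_unit = phi.
Proof.
move=> /biinvariantP Hphi; apply/ffunP => m; rewrite convE exchange_big /=.
transitivity (\sum_z hecke_unit z *
   (\sum_y phi y * ((y * z)%g == m)%:R)).
  apply: eq_bigr => y _; rewrite mulr_sumr; apply: eq_bigr => z _.
  by rewrite mulrCA.
rewrite sum_hecke_unitF (eq_bigr (fun=> phi m)) => [|k Kk].
  by rewrite sumr_const -[phi m *+ _]mulr_natl mulKf ?natK_neq0.
rewrite (bigD1 (m * uval k^-1)%g) //= eq_muluV eqxx mulr1 big1 ?addr0.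
  by rewrite -[m in LHS]mul1g (Hphi 1%g k^-1%g) ?groupV ?group1.
by move=> z /negPf nz; rewrite eq_muluV nz mulr0.
Qed.

Lemma hecke_unit_neq0 : hecke_unit != 0.
Proof.
apply/eqP => /ffunP/(_ 1%g); rewrite !ffunE ifT.
  by apply/eqP; rewrite invr_eq0 natK_neq0.
by apply/imsetP; exists 1%g; rewrite ?group1.
Qed.

Record hecke (h : [pchar F]^'.-nat #|K|) :=
  Hecke { hecke_fun : {ffun M -> F}; heckeP : hecke_fun \in biinvariant }.

End Hecke.

Arguments hecke {F M K} h.

Section HeckeAlgebra.

Variables (F : fieldType) (M : finMonoidType) (K : {group units M}).
Variable hK : [pchar F]^'.-nat #|K|.

HB.instance Definition _ := [isSub for @hecke_fun F M K hK].
HB.instance Definition _ := [Choice of hecke hK by <:].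
HB.instance Definition _ := [SubChoice_isSubZmodule of hecke hK by <:].

Definition hecke_one : hecke hK := Hecke hK (hecke_unit_biinvariant F K).
Definition hecke_mul (phi psi : hecke hK) : hecke hK :=
  Hecke hK (conv_biinvariant (heckeP phi) (heckeP psi)).

Lemma hecke_mulA : associative hecke_mul.
Proof. by move=> a b c; apply: val_inj; apply: convA. Qed.
Lemma hecke_mul1l : left_id hecke_one hecke_mul.
Proof. by move=> a; apply: val_inj; apply: conv_unitl (heckeP a). Qed.
Lemma hecke_mul1r : right_id hecke_one hecke_mul.
Proof. by move=> a; apply: val_inj; apply: conv_unitr (heckeP a). Qed.
Lemma hecke_mulDl : left_distributive hecke_mul +%R.
Proof. by move=> a b c; apply: val_inj; apply: convDl. Qed.
Lemma hecke_mulDr : right_distributive hecke_mul +%R.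
Proof. by move=> a b c; apply: val_inj; apply: convDr. Qed.
Lemma hecke_one_neq0 : hecke_one != 0.
Proof. by rewrite -val_eqE /= hecke_unit_neq0. Qed.

HB.instance Definition _ := GRing.Zmodule_isNzRing.Build (hecke hK)
  hecke_mulA hecke_mul1l hecke_mul1r hecke_mulDl hecke_mulDr hecke_one_neq0.

Lemma scale_biinvariant (a : F) (phi : {ffun M -> F}) :
  phi \in biinvariant K -> [ffun m => a * phi m] \in biinvariant K.
Proof.
move=> /biinvariantP Hphi; apply/biinvariantP => k1 k2 m K1 K2.
by rewrite !ffunE Hphi.
Qed.

Definition hecke_scale (a : F) (phi : hecke hK) : hecke hK :=
  Hecke hK (scale_biinvariant a (heckeP phi)).

Lemma hecke_scaleA a b phi :
  hecke_scale a (hecke_scale b phi) = hecke_scale (a * b) phi.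
Proof. by apply: val_inj; apply/ffunP => m; rewrite !ffunE mulrA. Qed.
Lemma hecke_scale1 : left_id 1 hecke_scale.
Proof. by move=> phi; apply: val_inj; apply/ffunP => m; rewrite !ffunE mul1r. Qed.
Lemma hecke_scaleDr : right_distributive hecke_scale +%R.
Proof.
by move=> a u v; apply: val_inj; apply/ffunP => m; rewrite !ffunE mulrDr.
Qed.
Lemma hecke_scaleDl v : {morph hecke_scale^~ v : a b / a + b}.
Proof.
by move=> a b; apply: val_inj; apply/ffunP => m; rewrite !ffunE mulrDl.
Qed.

HB.instance Definition _ := GRing.Zmodule_isLmodule.Build F (hecke hK)
  hecke_scaleA hecke_scale1 hecke_scaleDr hecke_scaleDl.

Lemma hecke_scaleAl (a : F) (u v : hecke hK) : a *: (u * v) = a *: u * v.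
Proof.
apply: val_inj; apply/ffunP => m; rewrite !ffunE mulr_sumr.
by apply: eq_bigr => p _; rewrite ffunE mulrA.
Qed.

HB.instance Definition _ :=
  GRing.Lmodule_isLalgebra.Build F (hecke hK) hecke_scaleAl.

Lemma hecke_scaleAr (a : F) (u v : hecke hK) : a *: (u * v) = u * (a *: v).
Proof.
apply: val_inj; apply/ffunP => m; rewrite !ffunE mulr_sumr.
by apply: eq_bigr => p _; rewrite ffunE mulrCA.
Qed.

HB.instance Definition _ :=
  GRing.Lalgebra_isAlgebra.Build F (hecke hK) hecke_scaleAr.

End HeckeAlgebra.

Section FixedVectors.

Variables (F : fieldType) (M : finMonoidType) (K : {group units M}).
Variables (V : lmodType F) (rho : representation M V).

Definition fixedv : {pred V} :=
  [pred v : V | [forall k in K, rho (uval k) v == v]].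

Lemma fixedvP (v : V) :
  reflect (forall k, k \in K -> rho (uval k) v = v) (v \in fixedv).
Proof. by apply: (iffP forall_inP) => Hv k Kk; apply/eqP/Hv. Qed.

Lemma fixedv_zmod : zmod_closed fixedv.
Proof.
split=> [|u v /fixedvP Hu /fixedvP Hv]; first by apply/fixedvP => k _; rewrite linear0.
by apply/fixedvP => k Kk; rewrite linearB Hu ?Hv.
Qed.

HB.instance Definition _ := GRing.isZmodClosed.Build V fixedv fixedv_zmod.

Lemma rep_fun_fixedv (phi : {ffun M -> F}) (v : V) :
  phi \in biinvariant K -> rep_fun rho phi v \in fixedv.
Proof.
move=> /biinvariantP Hphi; apply/fixedvP => k Kk.
rewrite /rep_fun linear_sum /=.
have hb : bijective (fun x : M => (uval k^-1 * x)%g).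
  exists (fun x : M => (uval k * x)%g) => x; rewrite mulgA.
    by rewrite uvalVr mul1g.
  by rewrite uvalVl mul1g.
rewrite (reindex _ (onW_bij _ hb)) /=; apply: eq_bigr => x _.
rewrite linearZ /= -rep_opM mulgA uvalVr mul1g.
congr (_ *: _); have := Hphi k^-1%g 1%g x; rewrite uval1 mulg1; apply.
  by rewrite groupV.
exact: group1.
Qed.

Record invariants (h : [pchar F]^'.-nat #|K|) :=
  Invariants { inv_val : V; invariantsP : inv_val \in fixedv }.

End FixedVectors.

Arguments invariants {F M K V} rho h.

Section HeckeModule.

Variables (F : fieldType) (M : finMonoidType) (K : {group units M}).
Variables (V : lmodType F) (rho : representation M V).
Variable hK : [pchar F]^'.-nat #|K|.

HB.instance Definition _ := [isSub for @inv_val F M K V rho hK].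
HB.instance Definition _ := [Choice of invariants rho hK by <:].
HB.instance Definition _ := [SubChoice_isSubZmodule of invariants rho hK by <:].

Definition hecke_act (phi : hecke hK) (v : invariants rho hK) :
    invariants rho hK :=
  Invariants hK (rep_fun_fixedv rho (inv_val v) (heckeP phi)).

Lemma hecke_actA phi psi v :
  hecke_act phi (hecke_act psi v) = hecke_act (phi * psi) v.
Proof.
apply: val_inj; rewrite /= /rep_fun sum_conv; apply: eq_bigr => y _.
rewrite linear_sum scaler_sumr; apply: eq_bigr => z _.
by rewrite linearZ /= rep_opM.
Qed.

Lemma hecke_act1 : left_id 1 hecke_act.
Proof.
move=> v; apply: val_inj; rewrite /= /rep_fun sum_hecke_unit.
have /fixedvP Hv := invariantsP v.
rewrite (eq_bigr (fun=> inv_val v)) => [|k Kk]; last exact: Hv.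
by rewrite sumr_const -scaler_nat scalerA mulVf ?natK_neq0 ?scale1r.
Qed.

Lemma hecke_actDr : right_distributive hecke_act +%R.
Proof.
move=> phi u v; apply: val_inj; rewrite /= /rep_fun -big_split /=.
by apply: eq_bigr => x _; rewrite linearD scalerDr.
Qed.

Lemma hecke_actDl v : {morph hecke_act^~ v : phi psi / phi + psi}.
Proof.
move=> phi psi; apply: val_inj; rewrite /= /rep_fun -big_split /=.
by apply: eq_bigr => x _; rewrite ffunE scalerDl.
Qed.

HB.instance Definition _ :=
  GRing.Zmodule_isLmodule.Build (hecke hK) (invariants rho hK)
    hecke_actA hecke_act1 hecke_actDr hecke_actDl.

End HeckeModule.

(* Main.v *)
Require Import Defs.
From HB Require Import structures.
From mathcomp Require Import all_boot all_order all_fingroup all_algebra.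
From mathcomp Require Import boolp.

Set Implicit Arguments.
Unset Strict Implicit.
Unset Printing Implicit Defensive.

Import GRing.Theory.
Local Open Scope ring_scope.

(* Fix a nonzero v0 in V^K and let w0 be its image in W^K. By irreducibility
   v0 and w0 generate V and W over F[M], so the two representations are
   isomorphic once v0 and w0 have the same annihilator in F[M]. If phi kills v0
   but not w0, then a left multiple theta of phi kills v0 and fixes w0;
   averaging theta over K on both sides yields an element of H_K that kills v0
   and multiplies w0 by the nonzero scalar |K|^2, which contradicts the
   H_K-linearity of the given isomorphism. *)

Section RepFun.

Variables (F : fieldType) (M : finMonoidType) (V : lmodType F).
Variable rho : representation M V.

Lemma rep_fun_linearl (a : F) (phi psi : {ffun M -> F}) (v : V) :
  rep_fun rho [ffun x => a * phi x + psi x] v = a *: rep_fun rho phi v + rep_fun rho psi v.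
Proof.
rewrite /rep_fun scaler_sumr -big_split /=; apply: eq_bigr => x _.
by rewrite ffunE scalerDl scalerA.
Qed.

Lemma rep_fun0l (v : V) : rep_fun rho 0 v = 0.
Proof. by rewrite /rep_fun big1 // => x _; rewrite ffunE scale0r. Qed.

Lemma rep_fun0r (phi : {ffun M -> F}) : rep_fun rho phi 0 = 0.
Proof. by rewrite /rep_fun big1 // => x _; rewrite linear0 scaler0. Qed.

Lemma rep_fun_conv (phi psi : {ffun M -> F}) (v : V) :
  rep_fun rho (conv phi psi) v = rep_fun rho phi (rep_fun rho psi v).
Proof.
rewrite /rep_fun sum_conv; apply: eq_bigr => y _.
rewrite linear_sum scaler_sumr; apply: eq_bigr => z _.
by rewrite rep_opM [in RHS]linearZ.
Qed.

Definition dirac (m : M) : {ffun M -> F} := [ffun x => (x == m)%:R].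

Lemma rep_fun_dirac (m : M) (v : V) : rep_fun rho (dirac m) v = rho m v.
Proof.
rewrite /rep_fun (bigD1 m) //= ffunE eqxx scale1r big1 ?addr0 // => x /negPf nx.
by rewrite ffunE nx scale0r.
Qed.

(** The boolean [==] lets [xchoose] extract a coefficient function [phi] from the existence
    proof. *)
Definition cyclic_vector (v : V) :=
  forall u : V, exists phi : {ffun M -> F}, rep_fun rho phi v == u.

(** The orbit of [v] under F[M] is a stable subspace, and it contains [v] because 1 acts as the
    identity; being nonzero, it is all of [V]. *)
Lemma irreducible_cyclic (v : V) :
  rep_irreducible rho -> v != 0 -> cyclic_vector v.
Proof.
move=> [_ irr] v_neq0.
(* Classical logic turns the orbit into a boolean predicate, as [rep_irreducible] expects. *)
pose U : {pred V} :=
  [pred u | `[< exists phi : {ffun M -> F}, rep_fun rho phi v == u >]].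
have [| |U0 | UT u] := irr U.
- split=> [|a _ _ /asboolP[phi /eqP<-] /asboolP[psi /eqP<-]]; apply/asboolP.
    by exists 0; rewrite rep_fun0l.
  by exists [ffun x => a * phi x + psi x]; rewrite rep_fun_linearl.
- move=> m _ /asboolP[phi /eqP<-]; apply/asboolP.
  by exists (conv (dirac m) phi); rewrite rep_fun_conv rep_fun_dirac.
- case/eqP: v_neq0; apply: U0; apply/asboolP.
  by exists (dirac 1%g); rewrite rep_fun_dirac rep_op1.
- exact/asboolP/UT.
Qed.

End RepFun.

Arguments dirac {F M} m.

Section CyclicMap.

Variables (F : fieldType) (M : finMonoidType) (V W : lmodType F).
Variables (pi : representation M V) (sigma : representation M W).

(** Sending [phi] applied to [v] to [phi] applied to [w] is well defined because the annihilator of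
    [v] lies in that of [w]. *)
Lemma cyclic_map (v : V) (w : W) :
  cyclic_vector pi v ->
  (forall phi, rep_fun pi phi v = 0 -> rep_fun sigma phi w = 0) ->
  exists g : {linear V -> W},
    forall phi, g (rep_fun pi phi v) = rep_fun sigma phi w.
Proof.
move=> cyc ann; pose g u := rep_fun sigma (xchoose (cyc u)) w.
have gE phi : g (rep_fun pi phi v) = rep_fun sigma phi w.
  rewrite /g; set psi := xchoose _.
  have /eqP psiE : rep_fun pi psi v == rep_fun pi phi v.
    exact: xchooseP (cyc _).
  (* The difference [psi - phi], written as [-1 * phi + psi], annihilates [v], hence [w]. *)
  apply/eqP; rewrite -subr_eq0 addrC -scaleN1r -rep_fun_linearl ann //.
  by rewrite rep_fun_linearl psiE scaleN1r addNr.
have g_lin : linear g.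
  move=> a u1 u2; have [/= phi1 /eqP <-] := cyc u1.
  have [/= phi2 /eqP <-] := cyc u2.
  by rewrite -rep_fun_linearl !gE rep_fun_linearl.
pose gL := GRing.isLinear.Build F V W _ g g_lin.
pose G : {linear V -> W} := HB.pack g gL.
by exists G.
Qed.

End CyclicMap.

(** The two inclusions of annihilators give maps both ways, which are mutually inverse on the orbits
    of [v] and [w]. The map is equivariant because [m] acts as [dirac m]. *)
Lemma cyclic_rep_iso (F : fieldType) (M : finMonoidType) (V W : lmodType F)
    (pi : representation M V) (sigma : representation M W) (v : V) (w : W) :
  cyclic_vector pi v -> cyclic_vector sigma w ->
  (forall phi, rep_fun pi phi v = 0 <-> rep_fun sigma phi w = 0) ->
  rep_iso pi sigma.
Proof.
move=> cycv cycw ann.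
have [g gE] := cyclic_map cycv (fun phi => proj1 (ann phi)).
have [g' g'E] := cyclic_map cycw (fun phi => proj2 (ann phi)).
exists g; split=> [|m u].
  exists g' => u; first by have [phi /eqP<-] := cycv u; rewrite gE g'E.
  by have [phi /eqP<-] := cycw u; rewrite g'E gE.
have [phi /eqP<-] := cycv u.
by rewrite -rep_fun_dirac -rep_fun_conv !gE rep_fun_conv rep_fun_dirac.
Qed.

Section Average.

Variables (F : fieldType) (M : finMonoidType) (K : {group units M}).

(** When |K| is invertible in [F], this is |K|^2 times e * phi * e, with e the idempotent
    [hecke_unit]. *)
Definition biaverage (phi : {ffun M -> F}) : {ffun M -> F} :=
  [ffun m => \sum_(k1 in K) \sum_(k2 in K) phi (uval k1 * m * uval k2)%g].

Lemma biaverage_biinvariant (phi : {ffun M -> F}) :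
  biaverage phi \in biinvariant K.
Proof.
apply/biinvariantP => a b m Ka Kb; rewrite !ffunE.
rewrite [RHS](reindex_inj (mulIg a)); apply: eq_big => [k1 | k1 _] /=.
  by rewrite groupMr.
rewrite [RHS](reindex_inj (mulgI b)); apply: eq_big => [k2 | k2 _] /=.
  by rewrite groupMl.
by rewrite !mulgA.
Qed.

Lemma rep_fun_biaverage (V : lmodType F) (rho : representation M V)
    (phi : {ffun M -> F}) (v : V) : v \in fixedv K rho ->
  rep_fun rho (biaverage phi) v
  = \sum_(k in K) #|K|%:R *: rho (uval k) (rep_fun rho phi v).
Proof.
move=> /fixedvP fixv; rewrite /rep_fun.
under eq_bigr => x _ do rewrite ffunE scaler_suml.
(* Inverting the index on the right matches the [k1^-1] that the substitution [h] below brings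
   out. *)
rewrite exchange_big [RHS](reindex_inj invg_inj) /=.
apply: eq_big => [k1 | k1 Kk1]; first by rewrite groupV.
under eq_bigr => x _ do rewrite scaler_suml.
rewrite exchange_big /= scaler_nat -sumr_const; apply: eq_bigr => k2 Kk2.
pose h (x : M) := (uval k1^-1 * x * uval k2^-1)%g.
have h_bij : bijective h.
  exists (fun x => (uval k1 * x * uval k2)%g) => x; rewrite /h.
    by rewrite !mulgA uvalVr mul1g -mulgA uvalVl mulg1.
  by rewrite !mulgA uvalVl mul1g -mulgA uvalVr mulg1.
rewrite (reindex h) /=; last exact: onW_bij.
rewrite linear_sum; apply: eq_bigr => x _.
rewrite /h !mulgA uvalVr mul1g -mulgA uvalVl mulg1 linearZ.
(* The factor [k2^-1] fixes [v], so all terms of the sum over [k2] agree, whence the scalar |K|. *)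
by rewrite !rep_opM (fixv k2^-1%g) ?groupV.
Qed.

End Average.

Lemma hecke_annihilator (F : fieldType) (M : finMonoidType)
    (K : {group units M}) (hK : [pchar F]^'.-nat #|K|) (V W : lmodType F)
    (pi : representation M V) (sigma : representation M W)
    (v : invariants pi hK) (w : invariants sigma hK) (phi : {ffun M -> F}) :
  rep_irreducible sigma ->
  (forall h : hecke hK, h *: v = 0 -> h *: w = 0) -> w != 0 ->
  rep_fun pi phi (inv_val v) = 0 -> rep_fun sigma phi (inv_val w) = 0.
Proof.
move=> irr ann w_neq0 phi_v; apply/eqP/negPn/negP => phi_w.
(* Since [phi] sends [w] to a nonzero vector, some [psi] brings that vector back to [w]. *)
have [psi /eqP psiE] := irreducible_cyclic irr phi_w (inv_val w).
pose theta := conv psi phi.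
pose h : hecke hK := Hecke hK (biaverage_biinvariant K theta).
have hv : h *: v = 0.
  apply: val_inj; rewrite /= rep_fun_biaverage ?invariantsP //.
  rewrite rep_fun_conv phi_v rep_fun0r big1 // => k _.
  by rewrite linear0 scaler0.
case/negP: w_neq0; apply/eqP/val_inj => /=.
have /(congr1 val)/= := ann h hv.
rewrite rep_fun_biaverage ?invariantsP // rep_fun_conv psiE.
have /fixedvP fixw := invariantsP w.
(* As [theta] sends [w] to itself and [K] fixes [w], the sum is |K|^2 times [w], with |K| nonzero in
   [F]. *)
rewrite (eq_bigr (fun=> #|K|%:R *: inv_val w)) => [|k Kk]; last by rewrite fixw.
rewrite sumr_const -scaler_nat => /eqP.
by rewrite !scaler_eq0 (negPf (natK_neq0 hK)) => /eqP.
Qed.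

Theorem theorem2p2 (F : fieldType) (M : finMonoidType) (K : {group units M})
    (hK : [pchar F]^'.-nat #|K|)
    (V W : lmodType F)
    (pi : representation M V) (sigma : representation M W)
    (pi_irr : rep_irreducible pi) (sigma_irr : rep_irreducible sigma)
    (VK_neq0 : exists v : invariants pi hK, v != 0)
    (WK_neq0 : exists w : invariants sigma hK, w != 0)
    (VK_iso_WK : exists f : {linear invariants pi hK -> invariants sigma hK},
       bijective f) :
  rep_iso pi sigma.
Proof.
have [v v_neq0] := VK_neq0; have [f f_bij] := VK_iso_WK.
have f_inj := bij_inj f_bij.
have fv_neq0 : f v != 0 by rewrite raddf_eq0.
have val_neq0 (U : lmodType F) (rho : representation M U)
    (u : invariants rho hK) : u != 0 -> inv_val u != 0.
  by apply: contra => /eqP u0; apply/eqP/val_inj.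
apply: (@cyclic_rep_iso _ _ _ _ _ _ (inv_val v) (inv_val (f v))).
- exact: irreducible_cyclic pi_irr (val_neq0 _ _ _ v_neq0).
- exact: irreducible_cyclic sigma_irr (val_neq0 _ _ _ fv_neq0).
move=> phi; split; apply: hecke_annihilator => // h.
  by move=> hv; rewrite -linearZ /= hv linear0.
(* The converse inclusion uses injectivity of [f]: [h] kills [f v], which forces [h *: v = 0]. *)
by rewrite -linearZ => /= hfv; apply: f_inj; rewrite hfv linear0.
Qed.
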